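(* Let $\sigma\ge1$, $\mu\ge1/2$ and $u\in\mathcal{S}'_{\sigma,\mu}(\mathbb{T}^m\times\mathbb{R}^n)$. Then for every $C_1,\varepsilon>0$ there exists $\tilde C_0=\tilde C_0(\varepsilon,C_1)>0$ such that $$|\langle\widehat{u}(k,x),f(x)\rangle|\leq\tilde C_0\|f\|_{\mu,C_1}e^{\varepsilon|k|^{1/\sigma}}$$ for every $f\in\mathcal{S}_\mu(\mathbb{R}^n)$ and $k\in\mathbb{Z}^m$, where $$\|f\|_{\mu,C_1}=\sup_{\alpha,\beta\in\mathbb{N}_0^n}C_1^{-|\alpha+\beta|}(\alpha!\beta!)^{-\mu}\sup_{x\in\mathbb{R}^n}|x^\alpha\partial_x^\beta f(x)|$$ (possibly $+\infty$).
   Context: $\mathbb{T}^m=(\mathbb{R}/2\pi\mathbb{Z})^m$. For $C>0$, $\mathcal{S}_{\sigma,\mu,C}(\mathbb{T}^m\times\mathbb{R}^n)$ is the Banach space of $\varphi\in C^\infty(\mathbb{T}^m\times\mathbb{R}^n)$ with $$\|\varphi\|_{\sigma,\mu,C}=\sup_{\alpha,\beta\in\mathbb{N}_0^n}\sup_{\gamma\in\mathbb{N}_0^m}C^{-|\alpha+\beta|-|\gamma|}\gamma!^{-\sigma}(\alpha!\beta!)^{-\mu}\sup_{(t,x)}|x^\alpha\partial_x^\beta\partial_t^\gamma\varphi(t,x)|<\infty;$$ $\mathcal{S}_{\sigma,\mu}(\mathbb{T}^m\times\mathbb{R}^n)=\bigcup_{C>0}\mathcal{S}_{\sigma,\mu,C}$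 with the inductive limit topology (a sequence converges iff it lies in and converges in some $\mathcal{S}_{\sigma,\mu,C}$), and $\mathcal{S}'_{\sigma,\mu}(\mathbb{T}^m\times\mathbb{R}^n)$ is the space of (sequentially) continuous linear functionals on it. $\mathcal{S}_\mu(\mathbb{R}^n)$ is the space of $f\in C^\infty(\mathbb{R}^n)$ with $\|f\|_{\mu,C}<\infty$ for some $C>0$, with the inductive limit topology, and $\mathcal{S}'_\mu(\mathbb{R}^n)$ is its dual. For $u\in\mathcal{S}'_{\sigma,\mu}(\mathbb{T}^m\times\mathbb{R}^n)$ and $k\in\mathbb{Z}^m$, $\widehat u(k,\cdot)\in\mathcal{S}'_\mu(\mathbb{R}^n)$ is defined by $\langle\widehat u(k,x),f(x)\rangle=\langle u(t,x),e^{ik\cdot t}f(x)\rangle$ for $f\in\mathcal{S}_\mu(\mathbb{R}^n)$. *)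

(* Defs.v *)
From HB Require Import structures.
From mathcomp Require Import all_boot all_order all_algebra.
From mathcomp Require Import all_classical all_reals all_analysis.
From mathcomp Require Import complex.

Set Implicit Arguments.
Unset Strict Implicit.
Unset Printing Implicit Defensive.

Import Order.TTheory GRing.Theory Num.Theory.
Import numFieldNormedType.Exports.
Import ComplexField.Normc.

Local Open Scope classical_set_scope.
Local Open Scope ring_scope.
Local Open Scope complex_scope.

Section MultiIndices.
Context {R : realType}.

Definition mi_abs n (a : 'I_n -> nat) : nat := (\sum_i a i)%N.

Definition mi_fact n (a : 'I_n -> nat) : nat := (\prod_i (a i)`!)%N.

Definition mi_pow n (x : 'rV[R]_n) (a : 'I_n -> nat) : R :=
  \prod_i x 0 i ^+ a i.

End MultiIndices.

(* R[i] carries no normed module structure over R in the library, so a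
   complex-valued function is differentiated through its real and imaginary
   parts. *)
Section Smoothness.
Context {R : realType} {V : normedModType R}.
Implicit Type f : V -> R[i].

Definition re_part f : V -> R := fun p => complex.Re (f p).

Definition im_part f : V -> R := fun p => complex.Im (f p).

Definition cderive (v : V) f : V -> R[i] :=
  fun p => ('D_v (re_part f) p) +i* ('D_v (im_part f) p).

Definition cderive_seq (I : Type) (e : I -> V) (s : seq I) f : V -> R[i] :=
  foldr (fun i => cderive (e i)) f s.

(* [e] is meant to be a basis of V: all iterated partial derivatives along [e]
   exist and are continuous. *)
Definition smooth (I : Type) (e : I -> V) f : Prop :=
  forall s : seq I,
    [/\ continuous (re_part (cderive_seq e s f)),
        continuous (im_part (cderive_seq e s f)) &
        forall (i : I) (p : V),
          derivable (re_part (cderive_seq e s f)) p (e i) /\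
          derivable (im_part (cderive_seq e s f)) p (e i)].

Definition pderive n (e : 'I_n -> V) (b : 'I_n -> nat) f : V -> R[i] :=
  cderive_seq e (flatten [seq nseq (b i) i | i <- enum 'I_n]) f.

End Smoothness.

Section GelfandShilov.
Context {R : realType}.
Implicit Types (n : nat) (mu C : R).

Definition stdvec n (i : 'I_n) : 'rV[R]_n := delta_mx 0 i.

Definition gs_norm n mu C (f : 'rV[R]_n -> R[i]) : \bar R :=
  ereal_sup (range (fun ab : ('I_n -> nat) * ('I_n -> nat) =>
    (C ^- mi_abs (fun i => ab.1 i + ab.2 i)%N
       * (mi_fact ab.1 * mi_fact ab.2)%N%:R `^ (- mu))%:E
    * ereal_sup (range (fun x : 'rV[R]_n =>
        (normc ((mi_pow x ab.1)%:C * pderive (@stdvec n) ab.2 f x))%:E))))%E.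

Definition gs_space n mu : set ('rV[R]_n -> R[i]) :=
  [set f | smooth (@stdvec n) f /\ exists2 C, 0 < C & (gs_norm mu C f < +oo)%E].

End GelfandShilov.

(* Functions on T^m x R^n, with T = R / (2 pi Z), are represented by functions
   on R^m x R^n that are 2 pi-periodic in each of the first m variables. *)
Section PeriodicGelfandShilov.
Context {R : realType} {m n : nat}.
Notation V := ('rV[R]_m * 'rV[R]_n)%type.
Implicit Types (phi psi : V -> R[i]) (sigma mu C : R).

Definition basis_t (j : 'I_m) : V := (stdvec j, 0).

Definition basis_x (i : 'I_n) : V := (0, stdvec i).

Definition basis_tx (i : 'I_m + 'I_n) : V :=
  match i with inl j => basis_t j | inr l => basis_x l end.

Definition periodic_t phi : Prop :=
  forall (j : 'I_m) (t : 'rV[R]_m) (x : 'rV[R]_n),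
    phi (t + (2 * pi) *: stdvec j, x) = phi (t, x).

Definition pgs_norm sigma mu C phi : \bar R :=
  ereal_sup (range (fun ab : ('I_n -> nat) * ('I_n -> nat) =>
    ereal_sup (range (fun c : 'I_m -> nat =>
      (C ^- (mi_abs (fun i => ab.1 i + ab.2 i)%N + mi_abs c)
         * (mi_fact c)%:R `^ (- sigma)
         * (mi_fact ab.1 * mi_fact ab.2)%N%:R `^ (- mu))%:E
      * ereal_sup (range (fun p : V =>
          (normc ((mi_pow p.2 ab.1)%:C
             * pderive basis_x ab.2 (pderive basis_t c phi) p))%:E))))))%E.

Definition pgs_space_at sigma mu C : set (V -> R[i]) :=
  [set phi | [/\ smooth basis_tx phi, periodic_t phi &
                 (pgs_norm sigma mu C phi < +oo)%E]].

Definition pgs_space sigma mu : set (V -> R[i]) :=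
  [set phi | exists2 C, 0 < C & pgs_space_at sigma mu C phi].

Definition pgs_cvg sigma mu (phi_ : nat -> V -> R[i]) phi : Prop :=
  exists C, [/\ 0 < C,
    forall j, pgs_space_at sigma mu C (phi_ j),
    pgs_space_at sigma mu C phi &
    pgs_norm sigma mu C (fun p => phi_ j p - phi p) @[j --> \oo] --> 0%E].

(* A functional is a total function on V -> R[i]; only its values on
   [pgs_space sigma mu] are meaningful. *)
Definition pgs_dual sigma mu : set ((V -> R[i]) -> R[i]) :=
  [set u |
    (forall (a : R[i]) phi psi,
       pgs_space sigma mu phi -> pgs_space sigma mu psi ->
       u (fun p => a * phi p + psi p) = a * u phi + u psi) /\
    (forall (phi_ : nat -> V -> R[i]) phi,
       pgs_cvg sigma mu phi_ phi ->
       normc (u (phi_ j) - u phi) @[j --> \oo] --> (0 : R))].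

Definition dotz (k : 'rV[int]_m) (t : 'rV[R]_m) : R :=
  \sum_j (k 0 j)%:~R * t 0 j.

Definition cexpi (theta : R) : R[i] := cos theta +i* sin theta.

Definition fourier_coef (u : (V -> R[i]) -> R[i]) (k : 'rV[int]_m)
    (f : 'rV[R]_n -> R[i]) : R[i] :=
  u (fun p => cexpi (dotz k p.1) * f p.2).

End PeriodicGelfandShilov.

Definition znorm {R : realType} m (k : 'rV[int]_m) : R :=
  Num.sqrt (\sum_j (k 0 j)%:~R ^+ 2).

(* Main.v *)
Require Import Defs.
From mathcomp Require Import all_boot all_order all_algebra.
From mathcomp Require Import all_classical all_reals all_analysis.
From mathcomp Require Import complex ring.
Import Order.TTheory GRing.Theory Num.Theory.
Import ComplexField.Normc.
Import numFieldNormedType.Exports.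
Local Open Scope classical_set_scope.
Local Open Scope ring_scope.

Set Implicit Arguments.
Unset Strict Implicit.
Unset Printing Implicit Defensive.

(** The proof is by contradiction.  Fix [C1] and [eps].  If no constant works,
    there are, for every natural number [N], a function [f_N] with finite norm
    and a frequency [k_N] such that [v_N = <u, e^{i k_N . t} f_N>] satisfies
    [|v_N| > (N + 1) ||f_N||_{mu, C1} e^{eps |k_N|^{1/sigma}}].  Put
    [phi_N = v_N^{-1} e^{i k_N . t} f_N].  Then [<u, phi_N> = 1] for all [N],
    whereas [phi_N] tends to [0] in [S_{sigma, mu, C}] for a suitable [C], which
    contradicts the sequential continuity of [u].

    The convergence rests on the norm bound [pgs_norm_twist_le],
      [||a e^{i k . t} f||_{sigma, mu, C}
         <= |a| e^{eps |k|^{1/sigma}} ||f||_{mu, C1}],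
    valid as soon as [C >= C1] and [C >= s^{-sigma}] with
    [s = eps / (sigma (m + 1))].  Since a [t]-derivative of order [gamma] only
    multiplies [e^{i k . t} f] by [(i k)^gamma] (lemma [pderive_twist]), the
    bound reduces to
      [C^{-|gamma|} gamma!^{-sigma} |k^gamma| <= e^{eps |k|^{1/sigma}}]
    (lemma [frequency_power_le]), which is the inequality [y^q / q! <= e^y],
    taken at [y = s |k_j|^{1/sigma}], raised to the power [sigma], and
    multiplied over the coordinates [j]. *)

(** * Growth of the powers of a frequency *)

(** The inequality [y ^+ n / n! <= expR y] at [y = s * x `^ sigma^-1], raised to
    the power [sigma]. *)
Lemma pow_fact_le (R : realType) (sigma s x : R) (n : nat) :
  1 <= sigma -> 0 < s -> 0 <= x ->
  x ^+ n * n`!%:R `^ (- sigma) <=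
    (s `^ (- sigma)) ^+ n * expR (sigma * s * x `^ sigma^-1).
Proof.
move=> s1 s0 x0.
have sg0 : 0 < sigma by rewrite (lt_le_trans _ s1).
have y0 : 0 <= x `^ sigma^-1 by exact: powR_ge0.
set y := x `^ sigma^-1 in y0 *.
have n0 : 0 < n`!%:R :> R by rewrite ltr0n fact_gt0.
have expR_ge : (s * y) ^+ n / n`!%:R <= expR (s * y).
  case: n n0 => [|n] n0.
    by rewrite expr0 fact0 divr1 -expR0 ler_expR mulr_ge0 // ltW.
  apply: le_trans (expR_ge1Dxn n _); last by rewrite mulr_ge0 // ltW.
  by rewrite lerDr.
have {}expR_ge : ((s * y) ^+ n / n`!%:R) `^ sigma <= expR (s * y) `^ sigma.
  apply: ge0_ler_powR => //; first exact: ltW.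
  - by rewrite nnegrE mulr_ge0 ?exprn_ge0 ?invr_ge0 ?mulr_ge0 // ltW.
  - by rewrite nnegrE expR_ge0.
rewrite -expRM in expR_ge.
have -> : sigma * s * y = s * y * sigma by ring.
apply: le_trans (ler_wpM2l _ expR_ge); last by rewrite exprn_ge0 ?powR_ge0.
have E1 : (s * y) `^ sigma = s `^ sigma * x.
  rewrite powRM ?(ltW s0) // /y -powRrM mulVf ?powRr1 //.
  by rewrite gt_eqF.
rewrite powRM ?invr_ge0 ?(ltW n0) ?exprn_ge0 ?mulr_ge0 ?(ltW s0) //.
have -> : ((s * y) ^+ n) `^ sigma = (s `^ sigma * x) ^+ n.
  rewrite -powR_mulrn ?mulr_ge0 ?(ltW s0) //.
  by rewrite powRAC powR_mulrn ?powR_ge0 // E1.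
have -> : n`!%:R^-1 `^ sigma = n`!%:R `^ (- sigma) :> R.
  by rewrite -powR_inv1 ?(ltW n0) // -powRrM mulN1r.
rewrite (powRN s) [leRHS]mulrA -exprMn mulrA mulVf ?mul1r //.
by rewrite gt_eqF // powR_gt0.
Qed.

Lemma powR_prod (R : realType) (I : finType) (F : I -> R) (r : R) :
  (forall i, 0 <= F i) -> (\prod_i F i) `^ r = \prod_i (F i `^ r).
Proof.
move=> F0.
suff [] : (\prod_i F i) `^ r = \prod_i (F i `^ r) /\ 0 <= \prod_i F i by [].
elim/big_rec2: _ => [|i y1 y2 _ [<- y0]]; first by rewrite powR1.
by rewrite powRM // mulr_ge0.
Qed.

Lemma le_znorm (R : realType) m (k : 'rV[int]_m) j :
  `|(k 0 j)%:~R| <= znorm k :> R.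
Proof.
rewrite -sqrtr_sqr /znorm ler_sqrt; last first.
  by apply: sumr_ge0 => i _; rewrite sqr_ge0.
rewrite (bigD1 j) //= lerDl; apply: sumr_ge0 => i _; exact: sqr_ge0.
Qed.

(** The weight of order [c] of the exponential of frequency [k] in the norm of
    [S_{sigma, mu, C}]: the modulus of the derivative of order [c] is
    [\prod_j `|k_j| ^+ c j]. *)
Lemma frequency_power_le (R : realType) m (sigma eps C : R)
    (k : 'rV[int]_m) (c : 'I_m -> nat) :
  1 <= sigma -> 0 < eps ->
  (eps / (sigma * m.+1%:R)) `^ (- sigma) <= C ->
  C ^- mi_abs c * (mi_fact c)%:R `^ (- sigma) *
    \prod_j `|(k 0 j)%:~R| ^+ c j <= expR (eps * znorm k `^ sigma^-1).
Proof.
move=> s1 e0; set s := eps / _ => DC.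
have sg0 : 0 < sigma by rewrite (lt_le_trans _ s1).
have s0 : 0 < s by rewrite divr_gt0 // mulr_gt0.
have D0 : 0 < s `^ (- sigma) by exact: powR_gt0.
have C0 : 0 < C by exact: lt_le_trans DC.
rewrite -mulrA ler_pdivrMl ?exprn_gt0 //.
rewrite /mi_fact natr_prod powR_prod // -big_split /=.
apply: (@le_trans _ _ (\prod_j (s `^ (- sigma) ^+ c j *
    expR (sigma * s * `|(k 0 j)%:~R| `^ sigma^-1)))).
  apply: ler_prod => j _; rewrite mulr_ge0 ?powR_ge0 ?exprn_ge0 //= mulrC.
  exact: pow_fact_le.
rewrite big_split /= prodrXr -/(mi_abs c) -expR_sum.
apply: ler_pM; rewrite ?exprn_ge0 ?expR_ge0 ?(ltW D0) //.
  by apply: lerXn2r => //; rewrite nnegrE ltW.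
rewrite ler_expR.
apply: (@le_trans _ _ (\sum_(j < m) sigma * s * znorm k `^ sigma^-1)).
  apply: ler_sum => j _; apply: ler_wpM2l; first by rewrite mulr_ge0 // ltW.
  apply: ge0_ler_powR; rewrite ?nnegrE ?invr_ge0 ?(ltW sg0) ?sqrtr_ge0 //.
  exact: le_znorm.
(* The sum of the m exponents is m / (m + 1) times the target exponent; the
   denominator m + 1 covers m = 0. *)
rewrite sumr_const card_ord -mulr_natr mulrAC.
apply: ler_wpM2r; first exact: powR_ge0.
have -> : sigma * s * m%:R = eps * (m%:R / m.+1%:R).
  rewrite /s; have : m.+1%:R != 0 :> R by rewrite pnatr_eq0.
  move: (m.+1%:R) => M M0; field.
  by rewrite M0 gt_eqF.
by rewrite ler_piMr ?(ltW e0) // ler_pdivrMr // mul1r ler_nat.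
Qed.

Local Open Scope complex_scope.

(** * Derivatives of complex-valued functions along a line *)

Lemma is_derive_lineP (R : realType) (V : normedModType R) (f : V -> R)
    (p v : V) (d : R) :
  is_derive p v f d <->
  is_derive (0 : R) (1 : R) (fun h : R => f (h *: v + p)) d.
Proof.
suff E : (fun h : R => h^-1 *: ((f \o shift p) (h *: v) - f p)) =
    (fun h : R => h^-1 *: (((fun h : R => f (h *: v + p)) \o shift 0) (h *: 1)
      - f (0 *: v + p))).
  by split=> -[]; rewrite /derivable /derive => df fd; split;
    rewrite /derivable /derive ?E // -?E.
by apply/funext => h /=; rewrite addr0 scale0r add0r [_%:A]mulr1.
Qed.

Lemma normc_ge0 (R : realType) (z : R[i]) : 0 <= normc z.
Proof. by case: z => x y; exact: sqrtr_ge0. Qed.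

Lemma normc_cexpi (R : realType) (x : R) : normc (cexpi x) = 1.
Proof. by rewrite /normc /= cos2Dsin2 sqrtr1. Qed.

Lemma is_derive_cos_line (R : realType) (c d : R) :
  is_derive (0 : R) (1 : R) (fun h : R => cos (h * c + d)) (- sin d * c).
Proof.
have affine : is_derive (0 : R) (1 : R) (fun h : R => h * c + d) c.
  by apply: is_derive_eq; rewrite ?addr0 ?scaler0 ?add0r /GRing.scale /= mulr1.
have := @is_derive1_comp R cos _ 0 (- sin (0 * c + d)) c
  (is_derive_cos _) affine.
by rewrite mul0r add0r.
Qed.

Lemma is_derive_sin_line (R : realType) (c d : R) :
  is_derive (0 : R) (1 : R) (fun h : R => sin (h * c + d)) (cos d * c).
Proof.
have affine : is_derive (0 : R) (1 : R) (fun h : R => h * c + d) c.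
  by apply: is_derive_eq; rewrite ?addr0 ?scaler0 ?add0r /GRing.scale /= mulr1.
have := @is_derive1_comp R sin _ 0 (cos (0 * c + d)) c
  (is_derive_sin _) affine.
by rewrite mul0r add0r.
Qed.

Lemma is_derive_lincomb (R : realType) (V : normedModType R) (f g : V -> R)
    (p v : V) (a b df dg : R) :
  is_derive p v f df -> is_derive p v g dg ->
  is_derive p v (fun q => a * f q + b * g q) (a * df + b * dg).
Proof.
move=> Hf Hg.
exact: (is_deriveD (is_deriveZ a Hf) (is_deriveZ b Hg)).
Qed.

(** [f] is differentiable at [p] in the direction [v] with complex derivative
    [d], real and imaginary parts being differentiated separately. *)
Definition is_cderive (R : realType) (V : normedModType R) (p v : V)
    (f : V -> R[i]) (d : R[i]) : Prop :=
  is_derive p v (re_part f) (complex.Re d) /\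
  is_derive p v (im_part f) (complex.Im d).

Lemma is_cderive_val (R : realType) (V : normedModType R) (p v : V) f d :
  @is_cderive R V p v f d -> cderive v f p = d.
Proof. by move=> [H1 H2]; rewrite /cderive !derive_val; case: d H1 H2. Qed.

Lemma is_cderiveZ (R : realType) (V : normedModType R) (p v : V)
    (f : V -> R[i]) (a d : R[i]) :
  is_cderive p v f d -> is_cderive p v (fun q => a * f q) (a * d).
Proof.
case: a d => [ar ai] [dr di] [/= H1 H2]; split.
  rewrite (_ : re_part _ =
      fun q => ar * re_part f q + - ai * im_part f q); last first.
    apply/funext => q; rewrite /re_part /im_part.
    by case: (f q) => fr fi /=; rewrite mulNr.
  by rewrite /= -mulNr; exact: is_derive_lincomb.
rewrite (_ : im_part _ =
    fun q => ar * im_part f q + ai * re_part f q); last first.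
  by apply/funext => q; rewrite /re_part /im_part; case: (f q).
exact: is_derive_lincomb.
Qed.

Lemma is_cderive_lineP (R : realType) (V : normedModType R) (p v : V)
    (f : V -> R[i]) (d : R[i]) :
  is_cderive p v f d <->
  is_cderive (0 : R) (1 : R) (fun h : R => f (h *: v + p)) d.
Proof.
split=> -[re_d im_d]; split.
- exact: (iffLR (is_derive_lineP _ _ _ _) re_d).
- exact: (iffLR (is_derive_lineP _ _ _ _) im_d).
- exact: (iffRL (is_derive_lineP _ _ _ _) re_d).
- exact: (iffRL (is_derive_lineP _ _ _ _) im_d).
Qed.

Lemma is_cderive_cexpi_line (R : realType) (c d : R) :
  is_cderive (0 : R) (1 : R) (fun h : R => cexpi (h * c + d))
    ((0 +i* c) * cexpi d).
Proof.
split; rewrite /re_part /im_part /=.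
  by rewrite mul0r add0r mulrC -mulNr; exact: is_derive_cos_line.
by rewrite mul0r add0r mulrC; exact: is_derive_sin_line.
Qed.

(** * The functions e^{i k.t} f(x) and their derivatives *)

(** The function [(t, x) |-> a e^{i k . t} f(x)].  Keeping the constant [a] in
    the definition makes this class of functions stable under all partial
    derivatives. *)
Definition twist (R : realType) m n (a : R[i]) (k : 'rV[int]_m)
    (f : 'rV[R]_n -> R[i]) : 'rV[R]_m * 'rV[R]_n -> R[i] :=
  fun p => a * (cexpi (dotz k p.1) * f p.2).

(** The constant produced by one differentiation in the direction [z]:
    [i k_j] in the direction [t_j], and [1] in a direction of [x]. *)
Definition twist_factor (R : realType) m n (k : 'rV[int]_m)
    (z : 'I_m + 'I_n) : R[i] :=
  if z is inl j then 0 +i* (k 0 j)%:~R else 1.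

(** The coordinate of [x] designated by [z], if any; its [pmap] extracts the
    [x]-derivatives from a sequence of mixed partial derivatives. *)
Definition space_index m n (z : 'I_m + 'I_n) : option 'I_n :=
  if z is inr i then Some i else None.

Lemma dotz_stdvec (R : realType) m (k : 'rV[int]_m) (t : 'rV[R]_m) (h : R) j :
  dotz k (h *: stdvec j + t) = h * (k 0 j)%:~R + dotz k t.
Proof.
rewrite /dotz /stdvec (eq_bigr (fun i =>
  (k 0 i)%:~R * (h * (i == j)%:R) + (k 0 i)%:~R * t 0 i)); last first.
  by move=> i _; rewrite !mxE mulrDr /=.
rewrite big_split /=; congr (_ + _).
rewrite (bigD1 j) //= big1 ?addr0 ?eqxx ?mulr1 1?mulrC // => i /negPf ->.
by rewrite !mulr0.
Qed.

Lemma is_cderive_twist (R : realType) m n (a : R[i]) (k : 'rV[int]_m)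
    (f : 'rV[R]_n -> R[i]) (z : 'I_m + 'I_n) (p : 'rV[R]_m * 'rV[R]_n) :
  (forall i x, derivable (re_part f) x (stdvec i) /\
               derivable (im_part f) x (stdvec i)) ->
  is_cderive p (basis_tx z) (twist a k f)
    (twist (a * twist_factor R k z) k
       (if space_index z is Some i then cderive (stdvec i) f else f) p).
Proof.
move=> df; apply/is_cderive_lineP; case: p => t x; case: z => [j|i] /=.
  rewrite (_ : (fun _ => _) = fun h : R =>
      (a * f x) * cexpi (h * (k 0 j)%:~R + dotz k t)); last first.
    apply/funext => h; rewrite /twist /= dotz_stdvec scaler0 add0r.
    by rewrite mulrAC mulrA.
  rewrite (_ : twist _ _ _ _ =
      (a * f x) * ((0 +i* (k 0 j)%:~R) * cexpi (dotz k t))); last first.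
    by rewrite /twist /=; ring.
  by apply: is_cderiveZ; exact: is_cderive_cexpi_line.
rewrite (_ : (fun _ => _) = fun h : R =>
    (a * cexpi (dotz k t)) * f (h *: stdvec i + x)); last first.
  by apply/funext => h; rewrite /twist /= scaler0 add0r mulrA.
rewrite (_ : twist _ _ _ _ =
    (a * cexpi (dotz k t)) * cderive (stdvec i) f x); last first.
  by rewrite /twist /= mulr1 mulrA.
apply: is_cderiveZ; apply/(is_cderive_lineP x (stdvec i) f).
by have [d1 d2] := df i x; split; exact: DeriveDef.
Qed.

Lemma cderive_seq_twist (R : realType) m n (a : R[i]) (k : 'rV[int]_m)
    (f : 'rV[R]_n -> R[i]) (s : seq ('I_m + 'I_n)) :
  smooth (@stdvec R n) f ->
  cderive_seq basis_tx s (twist a k f) =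
  twist (a * \prod_(z <- s) twist_factor R k z) k
    (cderive_seq (@stdvec R n) (pmap (@space_index m n) s) f).
Proof.
move=> sf; elim: s => [|z s IH]; first by rewrite big_nil mulr1.
rewrite /= IH big_cons; apply/funext => p.
have [_ _ df] := sf (pmap (@space_index m n) s).
rewrite (is_cderive_val (is_cderive_twist _ _ _ _ df)).
by rewrite -[_ * _ * _]mulrA [_ * twist_factor _ _ _]mulrC; case: z.
Qed.

Lemma continuous_dotz (R : realType) m n (k : 'rV[int]_m) :
  continuous (fun p : 'rV[R]_m * 'rV[R]_n => dotz k p.1).
Proof.
move=> p; rewrite /dotz; apply: cvg_big => [|j _].
  exact: add_continuous.
apply: cvgM; first exact: cvg_cst.
apply: (@continuous_comp _ _ _ fst (fun t : 'rV[R]_m => t 0 j)).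
  exact: cvg_fst.
exact: coord_continuous.
Qed.

Lemma smooth_twist (R : realType) m n (a : R[i]) (k : 'rV[int]_m)
    (f : 'rV[R]_n -> R[i]) :
  smooth (@stdvec R n) f -> smooth (@basis_tx R m n) (twist a k f).
Proof.
move=> sf s; rewrite (cderive_seq_twist _ _ _ sf).
set b := a * _; set s' := pmap _ s; set g := cderive_seq _ _ _.
have [cr ci dg] := sf s'; rewrite -/g in cr ci dg.
have cp (h : 'rV[R]_n -> R) : continuous h ->
    continuous (fun p : 'rV[R]_m * 'rV[R]_n => h p.2).
  move=> ch p; apply: (@continuous_comp _ _ _ snd h); last exact: ch.
  exact: cvg_snd.
have cc : continuous (fun p : 'rV[R]_m * 'rV[R]_n => cos (dotz k p.1)).
  move=> p; apply: (@continuous_comp _ _ _ (fun p => dotz k p.1) cos).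
    exact: continuous_dotz.
  exact: continuous_cos.
have cs : continuous (fun p : 'rV[R]_m * 'rV[R]_n => sin (dotz k p.1)).
  move=> p; apply: (@continuous_comp _ _ _ (fun p => dotz k p.1) sin).
    exact: continuous_dotz.
  exact: continuous_sin.
have {}cr := cp _ cr; have {}ci := cp _ ci.
split.
- rewrite (_ : re_part _ = fun p =>
    complex.Re b *
      (cos (dotz k p.1) * re_part g p.2 - sin (dotz k p.1) * im_part g p.2)
    - complex.Im b *
      (cos (dotz k p.1) * im_part g p.2 + sin (dotz k p.1) * re_part g p.2)).
    move=> p; apply: cvgB; (apply: cvgM; first exact: cvg_cst).
      by apply: cvgB; apply: cvgM; [exact: cc|exact: cr|exact: cs|exact: ci].
    by apply: cvgD; apply: cvgM; [exact: cc|exact: ci|exact: cs|exact: cr].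
  apply/funext => p; rewrite /re_part /im_part /twist /=.
  by case: (g p.2) (b) => [gr gi] [br bi].
- rewrite (_ : im_part _ = fun p =>
    complex.Re b *
      (cos (dotz k p.1) * im_part g p.2 + sin (dotz k p.1) * re_part g p.2)
    + complex.Im b *
      (cos (dotz k p.1) * re_part g p.2 - sin (dotz k p.1) * im_part g p.2)).
    move=> p; apply: cvgD; (apply: cvgM; first exact: cvg_cst).
      by apply: cvgD; apply: cvgM; [exact: cc|exact: ci|exact: cs|exact: cr].
    by apply: cvgB; apply: cvgM; [exact: cc|exact: cr|exact: cs|exact: ci].
  apply/funext => p; rewrite /re_part /im_part /twist /=.
  by case: (g p.2) (b) => [gr gi] [br bi].
- move=> z p; have [[d1 _] [d2 _]] := is_cderive_twist b k z p dg.
  by split.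
Qed.

Lemma periodic_twist (R : realType) m n (a : R[i]) (k : 'rV[int]_m)
    (f : 'rV[R]_n -> R[i]) : periodic_t (twist a k f).
Proof.
move=> j t x; rewrite /twist /= addrC dotz_stdvec; congr (a * (_ * _)).
have per (g : R -> R) : periodic g (pi *+ 2) ->
    forall (z : int) y, g (2 * pi * z%:~R + y) = g y.
  move=> pg z y; rewrite mulr_natl mulrzr.
  have pn := periodicn pg.
  case: z => q; first by rewrite -pmulrn (addrC _ y) pn.
  rewrite NegzE mulrNz -pmulrn.
  by rewrite -[y in RHS](subrK (pi *+ 2 *+ q.+1)) pn (addrC _ y).
by rewrite /cexpi (per _ (@cosD2pi R)) (per _ (@sinD2pi R)).
Qed.

Lemma pderive_twist (R : realType) m n (a : R[i]) (k : 'rV[int]_m)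
    (f : 'rV[R]_n -> R[i]) (b : 'I_n -> nat) (c : 'I_m -> nat) :
  smooth (@stdvec R n) f ->
  pderive basis_x b (pderive basis_t c (twist a k f)) =
  twist (a * \prod_j (0 +i* (k 0 j)%:~R) ^+ c j) k (pderive (@stdvec R n) b f).
Proof.
move=> sf.
have inlE (s : seq 'I_m) a' : cderive_seq basis_t s (twist a' k f) =
    twist (a' * \prod_(j <- s) (0 +i* (k 0 j)%:~R)) k f.
  transitivity (cderive_seq basis_tx (map inl s) (twist a' k f)).
    by rewrite /cderive_seq foldr_map.
  rewrite cderive_seq_twist // big_map.
  by rewrite (_ : pmap _ _ = [::]) //; elim: s.
have inrE (s : seq 'I_n) a' : cderive_seq basis_x s (twist a' k f) =
    twist a' k (cderive_seq (@stdvec R n) s f).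
  transitivity (cderive_seq basis_tx (map inr s) (twist a' k f)).
    by rewrite /cderive_seq foldr_map.
  rewrite cderive_seq_twist // big_map big1 ?mulr1 //.
  by rewrite (_ : pmap _ _ = s) //; elim: s => //= i s ->.
rewrite /pderive inlE inrE; congr (twist (_ * _) _ _).
rewrite big_flatten big_map big_enum /=; apply: eq_bigr => j _.
by rewrite big_nseq -Monoid.iteropE.
Qed.

(** * Norm estimates *)

Lemma gs_norm_ge0 (R : realType) n (mu C : R) (f : 'rV[R]_n -> R[i]) :
  0 < C -> (0 <= gs_norm mu C f)%E.
Proof.
move=> C0; pose z : 'I_n -> nat := fun=> 0%N.
apply: le_trans (ereal_sup_ubound _); last by exists (z, z).
apply: mule_ge0.
  by rewrite lee_fin mulr_ge0 ?powR_ge0 ?invr_ge0 ?exprn_ge0 ?ltW.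
apply: le_trans (ereal_sup_ubound _); last by exists 0.
by rewrite lee_fin normc_ge0.
Qed.

Lemma pgs_norm_ge0 (R : realType) m n (sigma mu C : R)
    (phi : 'rV[R]_m * 'rV[R]_n -> R[i]) :
  0 < C -> (0 <= pgs_norm sigma mu C phi)%E.
Proof.
move=> C0; pose z p : 'I_p -> nat := fun=> 0%N.
apply: le_trans (ereal_sup_ubound _); last by exists (z n, z n).
apply: le_trans (ereal_sup_ubound _); last by exists (z m).
apply: mule_ge0.
  by rewrite lee_fin !mulr_ge0 ?powR_ge0 ?invr_ge0 ?exprn_ge0 ?ltW.
apply: le_trans (ereal_sup_ubound _); last by exists 0.
by rewrite lee_fin normc_ge0.
Qed.

(** Each weighted pointwise value of a derivative of [f] is bounded by the norm. *)
Lemma gs_norm_le (R : realType) n (mu C r : R) (f : 'rV[R]_n -> R[i])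
    (a b : 'I_n -> nat) (x : 'rV[R]_n) :
  0 < C -> (gs_norm mu C f <= r%:E)%E ->
  C ^- mi_abs (fun i => a i + b i)%N * (mi_fact a * mi_fact b)%N%:R `^ (- mu)
    * normc ((mi_pow x a)%:C * pderive (@stdvec R n) b f x) <= r.
Proof.
move=> C0 fr; rewrite -lee_fin EFinM; apply: le_trans fr.
apply: le_trans (ereal_sup_ubound _); last by exists (a, b).
apply: lee_wpmul2l.
  by rewrite lee_fin mulr_ge0 ?powR_ge0 ?invr_ge0 ?exprn_ge0 ?ltW.
by apply: ereal_sup_ubound; exists x.
Qed.

(** Bounding [||f||_{mu, C1}] by a real number [r] keeps the estimate free of
    infinite values; [r = ||f||_{mu, C1}] is the intended case. *)
Lemma pgs_norm_twist_le (R : realType) m n (sigma mu C1 C eps r : R) (a : R[i])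
    (k : 'rV[int]_m) (f : 'rV[R]_n -> R[i]) :
  1 <= sigma -> 0 < eps -> 0 < C1 -> C1 <= C ->
  (eps / (sigma * m.+1%:R)) `^ (- sigma) <= C ->
  smooth (@stdvec R n) f -> (gs_norm mu C1 f <= r%:E)%E ->
  (pgs_norm sigma mu C (twist a k f) <=
    (normc a * (expR (eps * znorm k `^ sigma^-1) * r))%:E)%E.
Proof.
move=> s1 e0 C10 C1C DC sf fr; have C0 : 0 < C := lt_le_trans C10 C1C.
apply: ge_ereal_sup => _ [[al be] _ <-]; apply: ge_ereal_sup => _ [c _ <-] /=.
have f0 p (d : 'I_p -> nat) : 0 < (mi_fact d)%:R :> R.
  by rewrite ltr0n prodn_gt0 // => i; exact: fact_gt0.
have A0 : 0 < C ^- (mi_abs (fun i => al i + be i)%N + mi_abs c)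
    * (mi_fact c)%:R `^ (- sigma) * (mi_fact al * mi_fact be)%N%:R `^ (- mu).
  by rewrite !mulr_gt0 ?invr_gt0 ?exprn_gt0 ?powR_gt0 // natrM mulr_gt0.
rewrite -lee_pdivlMl //; apply: ge_ereal_sup => _ [[t x] _ <-].
rewrite lee_pdivlMl // -EFinM lee_fin pderive_twist // /twist /=.
rewrite !normcM normc_cexpi mul1r.
have -> : normc (\prod_j (0 +i* (k 0 j)%:~R) ^+ c j : R[i]) =
    \prod_j `|(k 0 j)%:~R| ^+ c j.
  rewrite (big_morph _ (@normcM R) (@normc1 R)); apply: eq_bigr => j _.
  elim: (c j) => [|q IH]; first by rewrite !expr0 normc1.
  by rewrite !exprS normcM IH /= expr0n add0r sqrtr_sqr.
have Fc := frequency_power_le k c s1 e0 DC.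
have Fr := gs_norm_le al be x C10 fr.
rewrite normcM in Fr.
set N := mi_abs _ in Fr *; set K := \prod_j _ in Fc *.
set W := normc (_%:C) in Fr *; set Z := normc (pderive _ _ _ _) in Fr *.
set P := _ `^ (- mu) in Fr *; set Q := _ `^ (- sigma) in Fc *.
have W0 : 0 <= W := normc_ge0 _.
have Z0 : 0 <= Z := normc_ge0 _.
have P0 : 0 <= P := powR_ge0 _ _.
have Q0 : 0 <= Q := powR_ge0 _ _.
have K0 : 0 <= K by apply: prodr_ge0 => j _; rewrite exprn_ge0.
have -> : C ^- (N + mi_abs c) * Q * P * (W * (normc a * K * Z)) =
    normc a * ((C ^- mi_abs c * Q * K) * (C ^- N * P * (W * Z))).
  by rewrite exprD invfM; ring.
apply: ler_wpM2l; first exact: normc_ge0.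
apply: ler_pM => //; rewrite ?mulr_ge0 ?invr_ge0 ?exprn_ge0 ?(ltW C0) //.
apply: le_trans Fr; rewrite -!mulrA; apply: ler_wpM2r.
  by rewrite !mulr_ge0.
rewrite lef_pV2 ?posrE ?exprn_gt0 //.
by apply: lerXn2r; rewrite // nnegrE ltW.
Qed.

(** * The growth of the Fourier coefficients *)

Theorem proposition3p9 (R : realType) (m n : nat) (sigma mu : R)
    (hsigma : 1 <= sigma) (hmu : 2^-1 <= mu)
    (u : ('rV[R]_m * 'rV[R]_n -> R[i]) -> R[i])
    (hu : pgs_dual sigma mu u) :
  forall C1 eps : R, 0 < C1 -> 0 < eps ->
  exists C0 : R, 0 < C0 /\
    forall (f : 'rV[R]_n -> R[i]) (k : 'rV[int]_m),
      gs_space mu f ->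
      ((normc (fourier_coef u k f))%:E <=
        C0%:E * gs_norm mu C1 f * (expR (eps * znorm k `^ sigma^-1))%:E)%E.
Proof.
move=> C1 eps C10 e0; have [ulin ucont] := hu.
pose C := Num.max C1 ((eps / (sigma * m.+1%:R)) `^ (- sigma)).
have C1C : C1 <= C by rewrite /C le_max lexx.
have DC : (eps / (sigma * m.+1%:R)) `^ (- sigma) <= C.
  by rewrite /C le_max lexx orbT.
have C0 : 0 < C := lt_le_trans C10 C1C.
pose E (k : 'rV[int]_m) := expR (eps * znorm k `^ sigma^-1).
apply: contrapT => noC.
(* A counterexample for every constant N + 1.  An infinite norm of f cannot
   contradict the bound, so r is the finite norm. *)
have bad (N : nat) : exists fk : ('rV[R]_n -> R[i]) * 'rV[int]_m,
    smooth (@stdvec R n) fk.1 /\ exists r : R,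
      [/\ 0 <= r, (gs_norm mu C1 fk.1 <= r%:E)%E &
          N.+1%:R * (E fk.2 * r) < normc (fourier_coef u fk.2 fk.1)].
  apply: contrapT => none; apply: noC; exists N.+1%:R; split=> // f k [sf _].
  have := gs_norm_ge0 mu f C10.
  case nf: (gs_norm mu C1 f) => [r| |] //; last first.
    move=> _; rewrite gt0_muley ?lte_fin //.
    by rewrite gt0_mulye ?lte_fin ?expR_gt0 // leey.
  rewrite lee_fin => r0; rewrite -!EFinM lee_fin leNgt; apply/negP => lt.
  apply: none; exists (f, k); split=> //; exists r; split=> //=.
    by rewrite nf.
  by rewrite [E k * r]mulrC mulrA.
have [fk fkP] := choice bad.
pose f N := (fk N).1; pose k N := (fk N).2.
pose v N := fourier_coef u (k N) (f N).
pose phi N := twist (v N)^-1 (k N) (f N).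
(* The strict inequality gives v_N <> 0, even when f_N has norm 0. *)
have v0 N : 0 < normc (v N).
  have [_ [r [r0 _]]] := fkP N; apply: le_lt_trans.
  by rewrite !mulr_ge0 // expR_ge0.
have in_space a N : pgs_space_at sigma mu C (twist a (k N) (f N)).
  have [sf [r [r0 fr _]]] := fkP N; split.
  - exact: smooth_twist.
  - exact: periodic_twist.
  - apply: le_lt_trans (ltry _).
    exact: (pgs_norm_twist_le a (k N) hsigma e0 C10 C1C DC sf fr).
(* The zero function belongs to the space because it is the product by a = 0. *)
have twist0 a N : a = 0 -> twist a (k N) (f N) = fun=> 0.
  by move=> ->; apply/funext => p; rewrite /twist mul0r.
have zero_in : @pgs_space_at R m n sigma mu C (fun=> 0).
  by have := in_space 0 0%N; rewrite twist0.
have in_pgs (psi : 'rV[R]_m * 'rV[R]_n -> R[i]) :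
    pgs_space_at sigma mu C psi -> pgs_space sigma mu psi.
  by exists C.
have u0 : u (fun=> 0) = 0.
  have := ulin 1 _ _ (in_pgs _ zero_in) (in_pgs _ zero_in).
  rewrite (_ : (fun _ => _) = fun=> 0); last first.
    by apply/funext => p; rewrite mulr0 addr0.
  by rewrite mul1r => /eqP; rewrite -subr_eq0 opprD addNKr oppr_eq0 => /eqP.
have uphi N : u (phi N) = 1.
  have h := ulin (v N)^-1 _ _ (in_pgs _ (in_space 1 N)) (in_pgs _ zero_in).
  rewrite u0 addr0 in h.
  have -> : phi N = fun p => (v N)^-1 * twist 1 (k N) (f N) p + 0.
    by apply/funext => p; rewrite /phi /twist mul1r addr0.
  rewrite h (_ : twist 1 _ _ = fun p => cexpi (dotz (k N) p.1) * f N p.2).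
    rewrite -/(fourier_coef u (k N) (f N)) mulVf //.
    by apply/eqP => vN0; have := v0 N; rewrite vN0 normc0 ltxx.
  by apply/funext => p; rewrite /twist mul1r.
have phi_cvg : pgs_cvg sigma mu phi (fun=> 0).
  exists C; split=> // [N|]; first exact: in_space.
  apply: (@squeeze_cvge _ _ _ _ (cst 0%E) _ (fun N => (N.+1%:R^-1)%:E)).
  - apply: nearW => N; rewrite pgs_norm_ge0 //=.
    rewrite (_ : (fun _ => _) = phi N); last first.
      by apply/funext => p; rewrite subr0.
    have [sf [r [r0 fr lt]]] := fkP N.
    apply: le_trans (pgs_norm_twist_le _ _ hsigma e0 C10 C1C DC sf fr) _.
    rewrite lee_fin normcV ler_pdivrMl // ler_pdivlMr // mulrC.
    exact: ltW.
  - exact: cvg_cst.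
  - apply: cvg_EFin; first exact: nearW.
    exact: cvg_harmonic.
have := ucont _ _ phi_cvg.
rewrite (_ : (fun _ => _) = cst (1 : R)); last first.
  by apply/funext => N; rewrite uphi u0 subr0 normc1.
move=> /(cvg_lim (@Rhausdorff R)) /eqP.
by rewrite lim_cst // oner_eq0.
Qed.
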